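(* Let $\mathbf{Z}$ be a finite-dimensional Zinbiel superalgebra over an arbitrary field. Then $\mathbf{Z}$ is nilpotent.
   Context: A Zinbiel superalgebra is a $\mathbb{Z}_2$-graded vector space $\mathbf{Z}=\mathbf{Z}_{\bar 0}\oplus\mathbf{Z}_{\bar 1}$ with a bilinear product satisfying $\mathbf{Z}_i\mathbf{Z}_j\subset\mathbf{Z}_{i+j}$ and $(xy)z=x\big(yz+(-1)^{|y||z|}zy\big)$ for all homogeneous $x,y,z$. Put $\mathbf{Z}^1=\mathbf{Z}$ and $\mathbf{Z}^{k+1}=\mathbf{Z}\,\mathbf{Z}^k$ (linear span of products). $\mathbf{Z}$ is nilpotent if $\mathbf{Z}^s=0$ for some $s\in\mathbb{N}$. *)

(* Defs.v *)
From HB Require Import structures.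
From mathcomp Require Import all_boot all_order all_algebra.

Set Implicit Arguments.
Unset Strict Implicit.
Unset Printing Implicit Defensive.

Import GRing.Theory.
Local Open Scope ring_scope.

(* A [vectType F] is finite-dimensional by construction.  Degrees in Z/2 are
   booleans ([false] for 0, [true] for 1), added with [addb]; in the exponent
   of the sign they are read as natural numbers 0 and 1.  Homogeneity is
   membership in a component, so the zero vector has both parities, which is
   harmless since the identity is trivial when x, y or z vanishes. *)
Record zinbiel_superalgebra (F : fieldType) (Z : vectType F)
    (gr : bool -> {vspace Z}) (mul : {bilinear Z -> Z -> Z}) : Prop :=
  ZinbielSuperalgebra {
    grading_direct : directv (gr false + gr true);
    grading_full : (gr false + gr true)%VS = fullv;
    mul_graded : forall (i j : bool) (x y : Z),
      x \in gr i -> y \in gr j -> mul x y \in gr (i (+) j);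
    zinbiel_identity : forall (i j k : bool) (x y z : Z),
      x \in gr i -> y \in gr j -> z \in gr k ->
      mul (mul x y) z = mul x (mul y z + (-1) ^+ (j * k)%N *: mul z y)
  }.

(* The span of all products [mul u v] with [u \in U] and [v \in V]; products of
   basis vectors suffice, see [mulv_subP]. *)
Definition mulv (F : fieldType) (Z : vectType F)
    (mul : {bilinear Z -> Z -> Z}) (U V : {vspace Z}) : {vspace Z} :=
  <<[seq mul u v | u <- vbasis U, v <- vbasis V]>>%VS.

Lemma mulv_subP (F : fieldType) (Z : vectType F)
    (mul : {bilinear Z -> Z -> Z}) (U V W : {vspace Z}) :
  reflect (forall u v, u \in U -> v \in V -> mul u v \in W)
          (mulv mul U V <= W)%VS.
Proof.
apply: (iffP idP) => [sW u v Uu Vv | sW].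
  apply: (subvP sW); rewrite (coord_vbasis Uu) (coord_vbasis Vv).
  rewrite linear_sumlz memv_suml // => i _.
  rewrite linear_sumr memv_suml // => j _.
  rewrite linearZl_LR linearZr_LR !memvZ // memv_span //.
  by apply: allpairs_f; rewrite memt_nth.
apply/span_subvP => _ /allpairsP[[u v] /= [Uu Vv ->]].
by rewrite sW ?vbasis_mem.
Qed.

(* Meaningful for [k >= 1]: the value at 1 is the whole space. *)
Definition zpow (F : fieldType) (Z : vectType F)
    (mul : {bilinear Z -> Z -> Z}) (k : nat) : {vspace Z} :=
  iter k.-1 (mulv mul fullv) fullv.

Definition nilpotent_product (F : fieldType) (Z : vectType F)
    (mul : {bilinear Z -> Z -> Z}) : Prop :=
  exists s : nat, (0 < s)%N /\ zpow mul s = 0%VS.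

(* Main.v *)
Require Import Defs.
From mathcomp Require Import all_boot all_order all_algebra.

Set Implicit Arguments.
Unset Strict Implicit.
Unset Printing Implicit Defensive.

Import GRing.Theory.
Local Open Scope ring_scope.

(* Write y * z = yz + (-1)^(|y||z|) zy, so that (xy)z = x(y * z).  Hence right
   multiplications by homogeneous elements commute up to sign, and they are
   nilpotent: an odd one squares to 0, and a non-nilpotent even one would give,
   by Fitting's argument, an idempotent right multiplication, which the identity
   rules out in every characteristic.

   If Z is not nilpotent, the powers of Z stabilise at an ideal W = ZW <> 0.
   For a linear phi that is nonzero on W put J(phi) = {x | phi(xW) = 0}, a
   proper subspace stable under right multiplication.  By the above there is a
   homogeneous e outside J(phi) with eZ inside J(phi).  Then psi = phi o L_e is
   nonzero on W and vanishes on all y * w, because e(y * w) = (ey)w.  If phi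
   also vanishes on all y * w, then phi(e(xw)) = +-phi((xe)w), so that J(psi)
   contains the homogeneous elements of J(phi), and contains e since ee is in
   J(phi).  Iterating, J grows forever, which is absurd in finite dimension. *)

(** Each strict inclusion lowers the dimension, so two consecutive terms agree; since the same [f]
    is iterated, all later terms then agree as well. *)
Lemma iter_vspace_stable (F : fieldType) (V : vectType F)
    (f : {vspace V} -> {vspace V}) (U : {vspace V}) :
  (forall k, (iter k.+1 f U <= iter k f U)%VS) ->
  exists k, forall j, iter (k + j) f U = iter k f U.
Proof.
move=> f_decr.
suff [k eq_k]: exists k, iter k.+1 f U = iter k f U.
  by exists k; elim=> [|j IHj]; rewrite ?addn0 // addnS iterS IHj.
have chain n : (exists k, iter k.+1 f U = iter k f U) \/
    (\dim (iter n f U) + n <= \dim U)%N.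
  elim: n => [|n [ex_k|le_n]]; [by right; rewrite addn0 | by left |].
  have [eq_n|neq_n] := eqVneq (iter n.+1 f U) (iter n f U).
    by left; exists n.
  right; apply: leq_trans le_n; rewrite addnS -addSn leq_add2r.
  by rewrite (ltn_leqif (dimv_leqif_eq (f_decr n))).
by case: (chain (\dim U).+1) => //; rewrite addnS ltnNge leq_addl.
Qed.

Section ZinbielSuperalgebra.

Variables (F : fieldType) (Z : vectType F) (gr : bool -> {vspace Z}).
Variable mul : {bilinear Z -> Z -> Z}.
Hypothesis hZ : zinbiel_superalgebra gr mul.

Local Notation "x ** y" := (mul x y) (at level 40, left associativity).
Local Notation sg j k := ((-1) ^+ (j * k)%N : F).

(** * Graded subspaces and ideals *)

Definition graded_subspace (W : {vspace Z}) :=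
  (W <= (W :&: gr false) + (W :&: gr true))%VS.

Lemma graded_ind (W : {vspace Z}) (P : Z -> Prop) :
  graded_subspace W -> (forall u v, P u -> P v -> P (u + v)) ->
  (forall i u, u \in W -> u \in gr i -> P u) ->
  forall u, u \in W -> P u.
Proof.
move=> grW PD Phom u /(subvP grW)/memv_addP[u0 + [u1 + ->]].
by move=> /memv_capP[Wu0 u0_0] /memv_capP[Wu1 u1_1]; apply: PD; apply: Phom; eauto.
Qed.

Lemma graded_fullv : graded_subspace fullv.
Proof. by rewrite /graded_subspace !capfv (grading_full hZ). Qed.

(** The sign does not involve the degree of [x], so additivity frees [x] from homogeneity. *)
Lemma zinbielE j k x y z : y \in gr j -> z \in gr k ->
  x ** y ** z = x ** (y ** z + sg j k *: (z ** y)).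
Proof.
move=> yj zk; move: x (memvf x).
apply: (graded_ind graded_fullv) => [u v Eu Ev|i x _ xi].
  by rewrite !linearDl /= Eu Ev.
exact: (zinbiel_identity hZ xi yj zk).
Qed.

Lemma mul_right_comm j k x y z : y \in gr j -> z \in gr k ->
  x ** y ** z = sg j k *: (x ** z ** y).
Proof.
move=> yj zk; rewrite (zinbielE _ yj zk) (zinbielE _ zk yj) -[RHS]linearZr_LR /=.
by rewrite scalerDr scalerA (mulnC k) -expr2 sqrr_sign scale1r addrC.
Qed.

Lemma mulv_graded (W : {vspace Z}) :
  graded_subspace W -> graded_subspace (mulv mul fullv W).
Proof.
move=> grW; rewrite /graded_subspace; set G := (X in (_ <= X)%VS).
apply/mulv_subP => u v _; move: v.
apply: (graded_ind grW) => [v w Gv Gw|j v Wv vj].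
  by rewrite linearDr memvD.
move: u (memvf u); apply: (graded_ind graded_fullv) => [u w Gu Gw|i u _ ui].
  by rewrite linearDl memvD.
have uvW : u ** v \in mulv mul fullv W.
  by have /mulv_subP-> := subvv (mulv mul fullv W); rewrite ?memvf.
have := mul_graded hZ ui vj; rewrite /G; case: (i (+) j) => uv_gr.
  by rewrite (subvP (addvSr _ _)) // memv_cap uvW.
by rewrite (subvP (addvSl _ _)) // memv_cap uvW.
Qed.

Definition absorbing (W : {vspace Z}) :=
  forall u v, v \in W -> (u ** v \in W) /\ (v ** u \in W).

(** On the right, [(xw)u = x(wu +- uw)] for homogeneous [w] and [u], and the bracket lies in [W]. *)
Lemma mulv_absorbing (W : {vspace Z}) : graded_subspace W -> absorbing W ->
  absorbing (mulv mul fullv W).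
Proof.
move=> grW aW.
have /mulv_subP ZW := subvv (mulv mul fullv W).
have sWW : (mulv mul fullv W <= W)%VS.
  by apply/mulv_subP => u v _ Wv; case: (aW u v Wv).
move=> u v Wv; split; first by rewrite ZW ?memvf ?(subvP sWW).
suff : (mulv mul fullv W <=
    linfun (applyr mul u) @^-1: mulv mul fullv W)%VS.
  by move/subvP/(_ v Wv); rewrite -memv_preim lfunE.
move: u (memvf u).
apply: (graded_ind graded_fullv) => [u u' Wu Wu'|i u _ ui].
  apply/subvP => w Ww; rewrite -memv_preim lfunE /= linearDr memvD //.
    by have := subvP Wu w Ww; rewrite -memv_preim lfunE.
  by have := subvP Wu' w Ww; rewrite -memv_preim lfunE.
apply/mulv_subP => x w _; move: w.
apply: (graded_ind grW) => [w w' Ww Ww'|j w Ww wj].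
  by rewrite linearDr memvD.
rewrite -memv_preim lfunE /= (zinbielE _ wj ui) ZW ?memvf //.
by case: (aW u w Ww) => uw wu; rewrite memvD ?memvZ.
Qed.

(** * Nilpotency of right multiplications *)

(* Doubling [f ** f] gives [f], so [f ** f ** f] doubled is both [f ** f] and
   [f]; then [f ** f = f] doubles to [f], whence [f = 0]. *)
Lemma right_idempotent_eq0 e : e \in gr false ->
  (forall x, x ** e ** e = x ** e) -> forall x, x ** e = 0.
Proof.
move=> e0 idem_e; pose f := e ** e.
have f0 : f \in gr false by exact: (mul_graded hZ e0 e0).
have xe x : x ** f + x ** f = x ** e.
  by rewrite -linearDr -(idem_e x) (zinbielE _ e0 e0) mul0n expr0 scale1r.
have ff2 : f ** f + f ** f = f by rewrite xe /f idem_e.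
have fff : f ** f ** f = f ** f.
  by rewrite (zinbielE _ f0 f0) mul0n expr0 scale1r ff2.
have ff : f ** f = f.
  by rewrite -[RHS]ff2 -{2 3}fff -linearDl ff2.
have f_eq0 : f = 0 by apply: (addrI f); rewrite -{1 2}ff ff2 addr0.
by move=> x; rewrite -xe f_eq0 linear0r addr0.
Qed.

Lemma iter_mulr_even b a k x : b \in gr false -> a \in gr false ->
  iter k (mul^~ b) x ** a = iter k (mul^~ b) (x ** a).
Proof.
move=> b0 a0; elim: k => //= k IHk.
by rewrite (mul_right_comm _ b0 a0) mul0n expr0 scale1r IHk.
Qed.

Lemma iter_mulr0 b k : iter k (mul^~ b) 0 = 0.
Proof. by elim: k => //= k ->; rewrite linear0l. Qed.

Lemma right_nilpotent_even b : b \in gr false ->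
  exists n, forall x, iter n (mul^~ b) x = 0.
Proof.
move=> b0; set r := mul^~ b.
(* For even [z], [(xz)b = x(T z)]: powers of [r] applied to [xz] become powers of [T] applied to
   [z]. *)
pose T : 'End(Z) := (linfun (mul b) + linfun (applyr mul b))%R.
have TE z : T z = b ** z + z ** b by rewrite add_lfunE !lfunE.
have T0 z : z \in gr false -> T z \in gr false.
  by move=> z0; rewrite TE memvD ?(mul_graded hZ b0 z0) ?(mul_graded hZ z0 b0).
have iterT0 k z : z \in gr false -> iter k T z \in gr false.
  by move=> z0; elim: k => //= k; apply: T0.
have mulT k x z : z \in gr false -> x ** iter k T z = iter k r (x ** z).
  move=> z0; elim: k => //= k <-.
  rewrite TE [RHS](zinbielE _ (iterT0 k z z0) b0) mul0n expr0 scale1r.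
  by rewrite [in RHS]addrC.
pose V k := iter k (lfun_img T) (gr false).
have VP k z : reflect (exists2 a, a \in gr false & z = iter k T a) (z \in V k).
  apply: (iffP idP) => [|[a a0 ->]].
    elim: k z => [|k IHk] z; first by exists z.
    by move=> /memv_imgP[_ /IHk[a a0 ->] ->]; exists a.
  by elim: k => //= k; apply: memv_img.
have [m Vm] : exists m, forall j, V (m + j)%N = V m.
  apply: iter_vspace_stable => k; apply/subvP => z /(VP k.+1)[a a0 ->].
  by apply/(VP k); exists (T a); rewrite ?T0 // -iterSr.
(* Since [x (T^m b) = r^m (xb) = r^(m+1) x], the exponent [2(m+1)] yields
   [r^(m+1) x = r^(2(m+1)) (xa)]. Then [T^(m+1) a] is the element whose right multiplication is
   idempotent. *)
have /VP[a a0 Tab] : iter m T b \in V (m.+1 + m.+1)%N.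
  by rewrite addSnnS Vm; apply/VP; exists b.
have r_ma x : iter m.+1 r x = iter m.+1 r (iter m.+1 r (x ** a)).
  by rewrite -iterD iterSr -(mulT m) // Tab mulT.
have idem x : x ** iter m.+1 T a ** iter m.+1 T a = x ** iter m.+1 T a.
  by rewrite !mulT // iter_mulr_even // -r_ma.
exists m.+1 => x; rewrite r_ma -mulT //.
by rewrite (right_idempotent_eq0 _ idem) ?iterT0 ?iter_mulr0.
Qed.

Lemma right_nilpotent i b : b \in gr i ->
  exists n, forall x, iter n (mul^~ b) x = 0.
Proof.
case: i => b_i; last exact: right_nilpotent_even.
exists 2 => x; rewrite /= (zinbielE _ b_i b_i) mul1n expr1 scaleN1r.
by rewrite subrr linear0r.
Qed.

(** * Annihilation modulo a subspace *)

Definition homogeneous x := exists i, x \in gr i.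

Lemma homogeneous_mul x y : homogeneous x -> homogeneous y ->
  homogeneous (x ** y).
Proof. by move=> [i xi] [j yj]; exists (i (+) j); exact: (mul_graded hZ xi yj). Qed.

Lemma homogeneous_iter_mulr n b x : homogeneous b -> homogeneous x ->
  homogeneous (iter n (mul^~ b) x).
Proof. by move=> hb hx; elim: n => //= n IHn; apply: homogeneous_mul. Qed.

(* The right multiplications by homogeneous elements are nilpotent and commute
   up to sign, hence have a common kernel modulo [J]. *)
Lemma right_annihilated_mod (J : {vspace Z}) :
  (forall x y, x \in J -> homogeneous y -> x ** y \in J) ->
  (exists2 x, homogeneous x & x \notin J) ->
  exists e, [/\ homogeneous e, e \notin J & forall y, e ** y \in J].
Proof.
move=> JZ exJ.
have seqP (s : seq Z) : (forall b, b \in s -> homogeneous b) ->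
    exists e, [/\ homogeneous e, e \notin J &
      forall b, b \in s -> e ** b \in J].
  elim: s => [_|b s IHs hs]; first by case: exJ => x; exists x.
  have [c cs|e [he eJ esJ]] := IHs; first by apply: hs; rewrite inE cs orbT.
  have hb : homogeneous b by apply: hs; rewrite mem_head.
  (* Replace [e] by its last iterate under [b] that is still outside [J]. *)
  have [k kJ kSJ] : exists2 k, iter k (mul^~ b) e \notin J &
      iter k.+1 (mul^~ b) e \in J.
    have [n rn] : exists n, forall x, iter n (mul^~ b) x = 0.
      by case: hb => i; apply: right_nilpotent.
    have ex_n : exists n, iter n (mul^~ b) e \in J by exists n; rewrite rn mem0v.
    case: (ex_minnP ex_n) => -[|k] kJ min_k; first by rewrite kJ in eJ.
    by exists k => //; apply: contraTN (ltnSn k) => /min_k; rewrite leqNgt.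
  exists (iter k (mul^~ b) e); split=> [||c] //.
    exact: homogeneous_iter_mulr.
  rewrite inE => /predU1P[-> //|cs].
  (* The earlier [c] still send the iterates into [J], as [(zb)c = +-(zc)b] and [J] is stable under
     [b]. *)
  elim: k {kJ kSJ} => [|k IHk] /=; first exact: esJ.
  have [j cj] : homogeneous c by apply: hs; rewrite inE cs orbT.
  have [i bi] := hb.
  by rewrite (mul_right_comm _ bi cj) memvZ // JZ.
have [b|e [he eJ eb]] := seqP (vbasis (gr false) ++ vbasis (gr true)).
  by rewrite mem_cat => /orP[]/vbasis_mem; [exists false | exists true].
exists e; split=> // y.
suff : (fullv <= linfun (mul e) @^-1: J)%VS.
  by move/subvP/(_ y (memvf y)); rewrite -memv_preim lfunE.
rewrite -(grading_full hZ) subv_add.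
rewrite -[gr false](span_basis (vbasisP _)) -[gr true](span_basis (vbasisP _)).
apply/andP; split; apply/span_subvP => b b_i;
  by rewrite -memv_preim lfunE eb // mem_cat b_i ?orbT.
Qed.

(** This is [J(phi)], cut out by a basis of [W]. Taking [phi] to be an endomorphism rather than a
    linear form lets the descent start at the identity. *)
Definition left_kernel (W : {vspace Z}) (phi : 'End(Z)) : {vspace Z} :=
  (\bigcap_(i < \dim W) lker (phi \o linfun (applyr mul (vbasis W)`_i)))%VS.

Lemma left_kernelP (W : {vspace Z}) (phi : 'End(Z)) x :
  reflect (forall w, w \in W -> phi (x ** w) = 0) (x \in left_kernel W phi).
Proof.
rewrite memvE; apply: (iffP subv_bigcapP) => [Jx w Ww|Jx i _].
  rewrite (coord_vbasis Ww) linear_sumr linear_sum big1 // => i _.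
  rewrite linearZr_LR linearZ /=; have := Jx i isT.
  by rewrite -memvE memv_ker comp_lfunE lfunE /= => /eqP->; rewrite scaler0.
rewrite -memvE memv_ker comp_lfunE lfunE /= Jx // vbasis_mem // mem_nth //.
by rewrite size_tuple.
Qed.

(** * The descent on left kernels *)

Section Descent.

Variable W : {vspace Z}.
Hypothesis W_graded : graded_subspace W.
Hypothesis W_absorbing : absorbing W.
Hypothesis W_stable : mulv mul fullv W = W.

Definition kills_symmetric (phi : 'End(Z)) := forall j k y w,
  y \in gr j -> w \in W -> w \in gr k -> phi (y ** w + sg j k *: (w ** y)) = 0.

Definition nonzero_on (phi : 'End(Z)) := exists2 w, w \in W & phi w != 0.

Lemma left_kernel_mulr (phi : 'End(Z)) x y :
  x \in left_kernel W phi -> homogeneous y -> x ** y \in left_kernel W phi.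
Proof.
move=> /left_kernelP Jx [j yj]; apply/left_kernelP.
apply: (graded_ind W_graded) => [u v Ju Jv|k w Ww wk].
  by rewrite linearDr linearD /= Ju Jv addr0.
rewrite (zinbielE _ yj wk) Jx //.
by have [yw wy] := W_absorbing y Ww; rewrite memvD ?memvZ.
Qed.

Lemma left_kernel_proper (phi : 'End(Z)) : nonzero_on phi ->
  exists2 x, homogeneous x & x \notin left_kernel W phi.
Proof.
case=> w0 Ww0 phi_w0.
have notJ b : ~~ (gr b <= left_kernel W phi)%VS ->
    exists2 x, homogeneous x & x \notin left_kernel W phi.
  by move/subvPn=> [x xb xJ]; exists x => //; exists b.
have [J0|] := boolP (gr false <= left_kernel W phi)%VS; last exact: notJ.
have [J1|] := boolP (gr true <= left_kernel W phi)%VS; last exact: notJ.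
have Jfull : (fullv <= left_kernel W phi)%VS.
  by rewrite -(grading_full hZ) subv_add J0 J1.
(* If [J(phi)] were everything, [phi] would kill [ZW = W]. *)
case/eqP: phi_w0; apply/eqP; rewrite -memv_ker.
apply: (subvP _ w0 Ww0); rewrite -W_stable; apply/mulv_subP => x w _ Ww.
have /left_kernelP Jx := subvP Jfull x (memvf x).
by rewrite memv_ker Jx.
Qed.

Lemma descent_step (phi : 'End(Z)) : nonzero_on phi ->
  exists e, [/\ homogeneous e, e \notin left_kernel W phi,
    forall y, e ** y \in left_kernel W phi,
    nonzero_on (phi \o linfun (mul e))%VF &
    kills_symmetric (phi \o linfun (mul e))%VF].
Proof.
move=> /left_kernel_proper/(right_annihilated_mod (@left_kernel_mulr phi)).
move=> [e [he eJ eZ]]; exists e; split=> //.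
  have /existsP[i phi_i] : [exists i : 'I_(\dim W), phi (e ** (vbasis W)`_i) != 0].
    apply: contraNT eJ => /existsPn phi0.
    rewrite memvE; apply/subv_bigcapP => i _.
    by rewrite -memvE memv_ker comp_lfunE lfunE /= -[_ == _]negbK phi0.
  exists (vbasis W)`_i; last by rewrite comp_lfunE lfunE.
  by rewrite vbasis_mem // mem_nth // size_tuple.
move=> j k y w yj Ww wk; rewrite comp_lfunE lfunE /= -(zinbielE _ yj wk).
by have /left_kernelP-> := eZ y.
Qed.

Lemma kills_symmetric_swap (phi : 'End(Z)) i x e :
  kills_symmetric phi -> x \in gr i -> homogeneous e ->
  x ** e \in left_kernel W phi ->
  x \in left_kernel W (phi \o linfun (mul e))%VF.
Proof.
move=> phi_sym xi [j ej] /left_kernelP Jxe; apply/left_kernelP.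
apply: (graded_ind W_graded) => [u v Ju Jv|k w Ww wk].
  by rewrite linearDr linearD /= Ju Jv addr0.
rewrite comp_lfunE lfunE /=.
have [xw _] := W_absorbing x Ww.
(* Up to sign, [phi] swaps [e] and [xw], and [(xw)e] is [(xe)w]. *)
have := phi_sym _ _ _ _ ej xw (mul_graded hZ xi wk).
rewrite linearD linearZ /= (mul_right_comm _ wk ej) linearZ /= Jxe //.
by rewrite !scaler0 addr0.
Qed.

(** [phi] need not be homogeneous, so [J(phi)] need not be graded; only its homogeneous elements are
    carried over to the next kernel, and they are what is counted. *)
Let rank (phi : 'End(Z)) :=
  (\dim (left_kernel W phi :&: gr false) +
   \dim (left_kernel W phi :&: gr true))%N.

Lemma descent_rank (phi : 'End(Z)) : kills_symmetric phi -> nonzero_on phi ->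
  exists psi, [/\ kills_symmetric psi, nonzero_on psi & (rank phi < rank psi)%N].
Proof.
move=> phi_sym /descent_step[e [he eJ eZ nz_psi psi_sym]].
set psi := (phi \o linfun (mul e))%VF in nz_psi psi_sym *.
exists psi; split=> //.
have sJ b : (left_kernel W phi :&: gr b <= left_kernel W psi :&: gr b)%VS.
  apply/subvP => x /memv_capP[Jx xb]; rewrite memv_cap xb andbT.
  by apply: (kills_symmetric_swap phi_sym xb) => //; apply: left_kernel_mulr.
have ltJ b : e \in gr b ->
    (\dim (left_kernel W phi :&: gr b) < \dim (left_kernel W psi :&: gr b))%N.
  move=> eb; rewrite (ltn_leqif (dimv_leqif_sup (sJ b))).
  apply: contra eJ => /subvP/(_ e); rewrite !memv_cap eb !andbT; apply.
  exact: (kills_symmetric_swap phi_sym eb).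
case: he => -[] /ltJ lt_e; rewrite /rank.
  by rewrite -addnS leq_add ?dimvS.
by rewrite -addSn leq_add ?dimvS.
Qed.

Lemma stable_eq0 : W = 0%VS.
Proof.
apply/eqP; apply: contraT => W_neq0.
have nz_id : nonzero_on \1%VF.
  by exists (vpick W); rewrite ?memv_pick // id_lfunE vpick0.
(* The identity need not satisfy [kills_symmetric]; one step from it gives a map that does. *)
have [e [_ _ _ nz_phi0 phi0_sym]] := descent_step nz_id.
have chain n : exists phi,
    [/\ kills_symmetric phi, nonzero_on phi & (n <= rank phi)%N].
  elim: n => [|n [phi [phi_sym nz_phi le_n]]].
    by exists (\1 \o linfun (mul e))%VF.
  have [psi [psi_sym nz_psi lt_psi]] := descent_rank phi_sym nz_phi.
  by exists psi; split=> //; apply: leq_ltn_trans le_n lt_psi.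
have [phi [_ _]] := chain (\dim (gr false) + \dim (gr true)).+1.
by rewrite ltnNge leq_add ?dimvS ?capvSr.
Qed.

End Descent.

End ZinbielSuperalgebra.

Theorem theorem34 (F : fieldType) (Z : vectType F) (gr : bool -> {vspace Z})
    (mul : {bilinear Z -> Z -> Z}%R) (hZ : zinbiel_superalgebra gr mul) :
  nilpotent_product mul.
Proof.
have ok k : graded_subspace gr (iter k (mulv mul fullv) fullv) /\
    absorbing mul (iter k (mulv mul fullv) fullv).
  elim: k => [|k [IHg IHa]] /=.
    by split; [exact: graded_fullv hZ | move=> u v _; rewrite !memvf].
  by split; [exact: (mulv_graded hZ) | exact: (mulv_absorbing hZ)].
have [k|k stab] := iter_vspace_stable (f := mulv mul fullv) (U := fullv).
  apply/mulv_subP => u v _ Wv.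
  by have [_ /(_ u v Wv)[]] := ok k.
(* [zpow] at [k.+1] is the [k]-th iterate. *)
exists k.+1; split=> //; have [grW aW] := ok k.
by apply: (stable_eq0 hZ) => //; have := stab 1; rewrite addn1.
Qed.
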